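(* Let $x\in\{2,3,5,9\}$ and suppose $(u,v,c)$ is an integer solution of the diophantine equation $$(2x)^2+u^2=v^2-\Big(v-\frac{x-1}{2}c\Big)^2$$ for which $u+v\equiv 0\pmod x$ and $c>0$, and further that $c$ is even when $x=2$ and that $c$ is not divisible by $3$ when $x=3$. For positive rational $t$ and numbers $a,b,c,d$ consider the conditions (i) $|c-b|\,t<a+c$; (ii) $(a+d)\,t>a+c$; (iii) $(b+c)\,t\neq a+c$. Then: (I) Let $t=x$, $a=v-u$, $b=(v+u)/t$, $d=a+c-b$, and suppose that conditions (i)–(iii) hold. Then there is a tangential LEQ $OABC$ with successive side lengths $OA=a$, $AB=b$, $BC=c$, $CO=d$ for which $(\sigma,\tau)=\big(\frac{t}{t-1},t\big)$. (II) Let $s=x$, $a=v-u$, $d=(v+u)/s$, $b=a+c-d$, and suppose that conditions (i)–(iii) hold for $t=\frac{s}{s-1}$ and that $b>0$. Then there is a tangential LEQ $OABC$ with successive side lengths $OA=a$, $AB=b$, $BC=c$, $CO=d$ for which $(\sigma,\tau)=(s,t)$. Furthermore, in both cases, if $OABC$ is concave, then the reflex angle is at $B$.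
   Context: A quadrilateral $OABC$ is given by four points of the plane, no three colinear, such that the segments $OA,AB,BC,CO$ have no interior points of intersection (no self-intersections); it may be convex or concave, and the vertices $O,A,B,C$ are written in positive (counterclockwise) cyclic order. A lattice equable quadrilateral (LEQ) is a quadrilateral whose vertices lie on $\mathbb Z^2$ and whose area equals its perimeter. A quadrilateral is tangential if it has an incircle, i.e. a circle inside it tangent to its four sides (in the concave case, to the sides or their extensions); by Pitot's theorem this is equivalent to $a+c=b+d$, where $a,b,c,d$ are the lengths of $OA,AB,BC,CO$. For a tangential LEQ $OABC$ define $$\sigma=\frac{ad+bc+2\delta\sqrt{abcd-4(a+c)^2}}{16+(a-b)^2},\qquad \tau=\frac{ab+cd-2\delta\sqrt{abcd-4(a+c)^2}}{16+(a-d)^2},$$ where $\delta=1$ if $B$ lies within the circumcircle of the triangle $OAC$, and $\delta=-1$ otherwise. *)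

(* Defs.v *)
From Stdlib Require Export Reals ZArith List.
From Stdlib Require Import ClassicalEpsilon.
Export ListNotations.
Open Scope R_scope.

Definition point : Type := (R * R)%type.

Definition distance (P Q : point) : R := dist_euc (fst P) (snd P) (fst Q) (snd Q).

Definition along (P Q : point) (s : R) : point :=
  ((1 - s) * fst P + s * fst Q, (1 - s) * snd P + s * snd Q).

Definition on_line (P Q T : point) : Prop := exists s, T = along P Q s.

Definition on_segment (P Q T : point) : Prop :=
  exists s, 0 <= s <= 1 /\ T = along P Q s.

Definition segment_interior (P Q T : point) : Prop :=
  exists s, 0 < s < 1 /\ T = along P Q s.

(* Twice the signed area of the triangle PQS: positive when P, Q, S turn
   counterclockwise, zero when they are collinear. *)
Definition orient (P Q S : point) : R :=
  (fst Q - fst P) * (snd S - snd P) - (snd Q - snd P) * (fst S - fst P).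

Definition collinear (P Q S : point) : Prop := orient P Q S = 0.

Definition in_triangle (X Y Z P : point) : Prop :=
  exists l m n, 0 <= l /\ 0 <= m /\ 0 <= n /\ l + m + n = 1 /\
    P = (l * fst X + m * fst Y + n * fst Z,
         l * snd X + m * snd Y + n * snd Z).

Definition sides (O A B C : point) : list (point * point) :=
  [(O, A); (A, B); (B, C); (C, O)].

(* Shoelace formula. *)
Definition signed_area (O A B C : point) : R :=
  fold_right Rplus 0
    (map (fun e => fst (fst e) * snd (snd e) - fst (snd e) * snd (fst e))
         (sides O A B C)) / 2.

(* For a simple quadrilateral this is the area of the enclosed region. *)
Definition area (O A B C : point) : R := Rabs (signed_area O A B C).

Definition perimeter (O A B C : point) : R :=
  distance O A + distance A B + distance B C + distance C O.

(* The last clause says that the vertices are listed counterclockwise. *)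
Definition quadrilateral (O A B C : point) : Prop :=
  ~ collinear O A B /\ ~ collinear A B C /\
  ~ collinear B C O /\ ~ collinear C O A /\
  ForallOrdPairs
    (fun e f => forall T, ~ (segment_interior (fst e) (snd e) T /\
                             segment_interior (fst f) (snd f) T))
    (sides O A B C) /\
  0 < signed_area O A B C.

Definition lattice_point (P : point) : Prop :=
  exists m n : Z, P = (IZR m, IZR n).

Definition LEQ (O A B C : point) : Prop :=
  quadrilateral O A B C /\
  (lattice_point O /\ lattice_point A /\ lattice_point B /\ lattice_point C) /\
  area O A B C = perimeter O A B C.

(* The interior angle at V exceeds pi: a counterclockwise boundary passing
   through P, V, N in succession turns clockwise at V. *)
Definition reflex (P V N : point) : Prop := orient P V N < 0.

Definition concave (O A B C : point) : Prop :=
  reflex C O A \/ reflex O A B \/ reflex A B C \/ reflex B C O.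

Definition separates (X Z Y W : point) : Prop :=
  orient X Z Y * orient X Z W < 0.

(* The closed region enclosed by a simple quadrilateral: an internal diagonal
   is one that separates the other two vertices, and it cuts the region into
   two triangles. In the convex case both diagonals give the same region. *)
Definition region (O A B C P : point) : Prop :=
  (separates O B A C /\ (in_triangle O A B P \/ in_triangle O B C P)) \/
  (separates A C O B /\ (in_triangle A B C P \/ in_triangle A C O P)).

(* T is a point of contact of the line PQ with the circle of centre Z and
   radius r: it is on both, and the radius ZT is perpendicular to PQ. *)
Definition tangent_at (Z : point) (r : R) (P Q T : point) : Prop :=
  on_line P Q T /\ distance Z T = r /\
  (fst T - fst Z) * (fst Q - fst P) + (snd T - snd Z) * (snd Q - snd P) = 0.

(* In the concave case the circle may touch the extension of a side. *)
Definition incircle (O A B C Z : point) (r : R) : Prop :=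
  0 < r /\
  (forall P, distance Z P <= r -> region O A B C P) /\
  Forall (fun e => exists T,
            tangent_at Z r (fst e) (snd e) T /\
            (on_segment (fst e) (snd e) T \/ concave O A B C))
         (sides O A B C).

Definition tangential (O A B C : point) : Prop :=
  exists Z r, incircle O A B C Z r.

(* P lies strictly inside the circle through X, Y, W. A tangential LEQ with B
   on the circle through O, A, C is cyclic, so a b c d is the squared area
   4 (a + c)^2 and the term multiplied by delta below vanishes. *)
Definition within_circumcircle (X Y W P : point) : Prop :=
  exists Z, distance Z X = distance Z Y /\ distance Z Y = distance Z W /\
            distance Z P < distance Z X.

Definition delta (O A B C : point) : R :=
  if excluded_middle_informative (within_circumcircle O A C B) then 1 else -1.

Definition leq_sigma (O A B C : point) : R :=
  let a := distance O A in let b := distance A B in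
  let c := distance B C in let d := distance C O in
  (a * d + b * c
     + 2 * delta O A B C * sqrt (a * b * c * d - 4 * (a + c) ^ 2))
  / (16 + (a - b) ^ 2).

Definition leq_tau (O A B C : point) : R :=
  let a := distance O A in let b := distance A B in
  let c := distance B C in let d := distance C O in
  (a * b + c * d
     - 2 * delta O A B C * sqrt (a * b * c * d - 4 * (a + c) ^ 2))
  / (16 + (a - d) ^ 2).

Definition side_conditions (t a b c d : R) : Prop :=
  Rabs (c - b) * t < a + c /\
  (a + d) * t > a + c /\
  (b + c) * t <> a + c.

Definition has_side_lengths (O A B C : point) (a b c d : R) : Prop :=
  distance O A = a /\ distance A B = b /\ distance B C = c /\ distance C O = d.

(* Main.v *)
(* Let [e], [f], [g], [h] be the tangent lengths at [O], [A], [B], [C], so that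
   a = e + f, b = f + g, c = g + h, d = h + e, with g < 0 exactly when the angle
   at [B] is reflex. The inradius is 2 and, with l = a + c, sigma = l / (e + g) and
   tau = l / (f + h); the condition on the inradius becomes
   e g sigma + f h tau = 4 sigma tau. Given the sides and (sigma, tau) these
   relations determine the tangent lengths, conditions (i)-(iii) say that f, h > 0,
   e > 0 and g <> 0, and the diophantine equation is the condition on the inradius.
   This yields a quadrilateral with A = (a, 0), in which the inner and cross
   products of the vectors OA, OB, OC are integers. If k is a greatest
   common divisor of the Gaussian integers a, a B, a C, this integrality implies
   that the rotation by conj k / k sends A, B, C to lattice points. *)

Require Import Defs.
From Stdlib Require Import Lra Psatz Lia ClassicalEpsilon.
Open Scope R_scope.

(** * Distances, orientations and simple quadrilaterals *)

Lemma distance_of_sq (P Q : point) (l : R) :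
  0 <= l -> (fst Q - fst P) ^ 2 + (snd Q - snd P) ^ 2 = l ^ 2 -> distance P Q = l.
Proof.
  intros Hl H. unfold distance, dist_euc.
  rewrite <- (sqrt_Rsqr l Hl). f_equal. unfold Rsqr. lra.
Qed.

Lemma distance_sq (P Q : point) :
  distance P Q ^ 2 = (fst Q - fst P) ^ 2 + (snd Q - snd P) ^ 2.
Proof.
  unfold distance, dist_euc. rewrite pow2_sqrt; [unfold Rsqr; ring|].
  apply Rplus_le_le_0_compat; apply Rle_0_sqr.
Qed.

Lemma distance_ge0 (P Q : point) : 0 <= distance P Q.
Proof. apply sqrt_pos. Qed.

Lemma distance_eq_sq (P Q P' Q' : point) :
  distance P Q = distance P' Q' <->
  (fst Q - fst P) ^ 2 + (snd Q - snd P) ^ 2 = (fst Q' - fst P') ^ 2 + (snd Q' - snd P') ^ 2.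
Proof.
  rewrite <- !distance_sq. pose proof (distance_ge0 P Q). pose proof (distance_ge0 P' Q').
  split; intros; nra.
Qed.

Lemma distance_lt_sq (P Q P' Q' : point) :
  distance P Q < distance P' Q' <->
  (fst Q - fst P) ^ 2 + (snd Q - snd P) ^ 2 < (fst Q' - fst P') ^ 2 + (snd Q' - snd P') ^ 2.
Proof.
  rewrite <- !distance_sq. pose proof (distance_ge0 P Q). pose proof (distance_ge0 P' Q').
  split; intros; nra.
Qed.

Lemma orient_along_side (P Q X Y : point) (s : R) :
  orient P Q (along X Y s) = (1 - s) * orient P Q X + s * orient P Q Y.
Proof. destruct P, Q, X, Y. unfold orient, along. simpl. ring. Qed.

Lemma orient_along_self (P Q : point) (s : R) : orient P Q (along P Q s) = 0.
Proof. destruct P, Q. unfold orient, along. simpl. ring. Qed.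

Lemma orient_cycle (P Q T : point) : orient P Q T = orient Q T P.
Proof. destruct P, Q, T. unfold orient. simpl. ring. Qed.

(** Points of [PQ] have orientation zero against the line [PQ], while the point of [QT] at parameter
    [r] has orientation [r * orient P Q T]. *)
Lemma adjacent_interiors_disjoint (P Q T X : point) :
  orient P Q T <> 0 ->
  ~ (segment_interior P Q X /\ segment_interior Q T X).
Proof.
  intros H [[s [Hs ->]] [r [Hr E]]].
  pose proof (orient_along_self P Q s) as E1.
  rewrite E, orient_along_side in E1.
  replace (orient P Q Q) with 0 in E1 by (unfold orient; ring).
  assert (r * orient P Q T = 0) by lra.
  apply Rmult_integral in H0. lra.
Qed.

Lemma opposite_interiors_disjoint (P Q T U X : point) :
  0 < orient P Q T -> 0 < orient P Q U ->
  ~ (segment_interior P Q X /\ segment_interior T U X).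
Proof.
  intros HT HU [[s [Hs ->]] [r [Hr E]]].
  pose proof (orient_along_self P Q s) as E1.
  rewrite E, orient_along_side in E1. nra.
Qed.

Lemma signed_area_orient (O A B C : point) :
  signed_area O A B C = (orient O A B + orient B C O) / 2.
Proof. unfold signed_area, orient, sides. simpl. field. Qed.

(** Opposite sides are separated by the lines [OA] and [CO] alone, so the sign of [orient A B C]
    stays free and a reflex angle at [B] is covered. *)
Lemma quadrilateral_of_orient (O A B C : point) :
  0 < orient O A B -> orient A B C <> 0 -> 0 < orient B C O -> 0 < orient C O A ->
  quadrilateral O A B C.
Proof.
  intros H1 H2 H3 H4. unfold quadrilateral, collinear.
  repeat split; try lra.
  - assert (HOAC : 0 < orient O A C) by (rewrite <- orient_cycle; exact H4).
    assert (HCOB : 0 < orient C O B) by (rewrite <- orient_cycle; exact H3).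
    unfold sides.
    repeat (constructor; simpl); intros T HT.
    + revert HT. apply adjacent_interiors_disjoint; lra.
    + revert HT. apply opposite_interiors_disjoint; assumption.
    + destruct HT as [HT1 HT2]. apply (adjacent_interiors_disjoint C O A T); [lra | easy].
    + revert HT. apply adjacent_interiors_disjoint; lra.
    + destruct HT as [HT1 HT2]. apply (opposite_interiors_disjoint C O A B T); try easy.
    + revert HT. apply adjacent_interiors_disjoint; lra.
  - rewrite signed_area_orient. lra.
Qed.

(** * Triangles, tangent lines and the enclosed region *)

(** The barycentric coordinates of [P] are quotients of orientations. *)
Lemma in_triangle_of_orient (X Y Z P : point) :
  0 < orient X Y Z -> 0 <= orient X Y P -> 0 <= orient Y Z P -> 0 <= orient Z X P ->
  in_triangle X Y Z P.
Proof.
  intros H0 H1 H2 H3.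
  exists (orient Y Z P / orient X Y Z), (orient Z X P / orient X Y Z),
    (orient X Y P / orient X Y Z).
  assert (Hd : forall r, 0 <= r -> 0 <= r / orient X Y Z).
  { intros. apply Rmult_le_pos; [easy | left; now apply Rinv_0_lt_compat]. }
  repeat split; auto.
  - destruct X, Y, Z, P. unfold orient in *. simpl in *. field. lra.
  - destruct X, Y, Z, P. unfold orient in *. simpl in *. f_equal; field; lra.
Qed.

(** When [l] is positive, [Z] lies at distance [r] to the left of the line [PQ], so the disc of
    radius [r] about [Z] stays on that side. *)
Lemma orient_near (P Q Z X : point) (l r : R) :
  (fst Q - fst P) ^ 2 + (snd Q - snd P) ^ 2 = l ^ 2 -> 0 <= l -> 0 <= r ->
  orient P Q Z = l * r -> distance Z X <= r -> 0 <= orient P Q X.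
Proof.
  intros Hl Hl0 Hr HZ HX.
  assert (HX2 : (fst X - fst Z) ^ 2 + (snd X - snd Z) ^ 2 <= r ^ 2).
  { rewrite <- distance_sq. pose proof (distance_ge0 Z X). nra. }
  set (w := (fst Q - fst P) * (snd X - snd Z) - (snd Q - snd P) * (fst X - fst Z)).
  assert (Hw : orient P Q X = l * r + w) by (rewrite <- HZ; unfold w, orient; ring).
  assert (Hw2 : w ^ 2 <= (l * r) ^ 2).
  (* Lagrange's identity for the inner product [v] and the cross product [w] of the vectors [PQ] and
     [ZX] bounds [w]. *)
  { set (v := (fst Q - fst P) * (fst X - fst Z) + (snd Q - snd P) * (snd X - snd Z)).
    assert (w ^ 2 + v ^ 2 = l ^ 2 * ((fst X - fst Z) ^ 2 + (snd X - snd Z) ^ 2))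
      by (rewrite <- Hl; unfold w, v; ring).
    pose proof (Rmult_le_compat_l (l ^ 2) _ _ (pow2_ge_0 l) HX2). nra. }
  rewrite Hw. assert (0 <= l * r) by nra. nra.
Qed.

(** Here [m] is the signed distance from [P] to the foot of the perpendicular from [Z]. The cross
    product [l * r] and the inner product [m * l] with [PQ] determine [Z - P]. *)
Lemma tangent_at_foot (P Q Z : point) (l r m : R) :
  0 < l -> 0 <= r ->
  (fst Q - fst P) ^ 2 + (snd Q - snd P) ^ 2 = l ^ 2 ->
  orient P Q Z = l * r ->
  (fst Z - fst P) * (fst Q - fst P) + (snd Z - snd P) * (snd Q - snd P) = m * l ->
  tangent_at Z r P Q (along P Q (m / l)).
Proof.
  intros Hl Hr H1 H2 H3. split; [eexists; reflexivity|].
  destruct P as [p1 p2], Q as [q1 q2], Z as [z1 z2].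
  unfold orient, along in *; simpl in *.
  set (x := q1 - p1) in *. set (y := q2 - p2) in *.
  assert (Hq1 : q1 = p1 + x) by (unfold x; ring).
  assert (Hq2 : q2 = p2 + y) by (unfold y; ring).
  set (zx := z1 - p1) in *. set (zy := z2 - p2) in *.
  assert (Hz1 : z1 = p1 + zx) by (unfold zx; ring).
  assert (Hz2 : z2 = p2 + zy) by (unfold zy; ring).
  assert (Ezx : zx = (m * x - r * y) / l).
  { apply (Rmult_eq_reg_r (l * l)); [|nra].
    replace ((m * x - r * y) / l * (l * l)) with ((m * l) * x - (l * r) * y) by (field; lra).
    rewrite <- H2, <- H3. replace (l * l) with (x * (x * 1) + y * (y * 1)) by (rewrite H1; ring).
    ring. }
  assert (Ezy : zy = (m * y + r * x) / l).
  { apply (Rmult_eq_reg_r (l * l)); [|nra].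
    replace ((m * y + r * x) / l * (l * l)) with ((m * l) * y + (l * r) * x) by (field; lra).
    rewrite <- H2, <- H3. replace (l * l) with (x * (x * 1) + y * (y * 1)) by (rewrite H1; ring).
    ring. }
  clearbody x y zx zy. subst q1 q2 z1 z2 zx zy. split.
  - apply distance_of_sq; [easy|]. simpl.
    transitivity (r * r * ((x * (x * 1) + y * (y * 1))) / (l * l)); [field; lra|].
    rewrite H1. field. lra.
  - field. lra.
Qed.

(** The diagonal [OB] is internal, since [A] and [C] lie on opposite sides of it; the side of [OB]
    on which [P] lies selects the triangle. *)
Lemma region_of_orient (O A B C P : point) :
  0 < orient O A B -> 0 < orient B C O ->
  0 <= orient O A P -> 0 <= orient A B P -> 0 <= orient B C P -> 0 <= orient C O P ->
  region O A B C P.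
Proof.
  intros H1 H2 PA PB PC PO. left. split.
  - unfold separates.
    assert (orient O B A = - orient O A B) by (unfold orient; ring).
    assert (orient O B C = orient B C O) by (unfold orient; ring). nra.
  - destruct (Rle_dec 0 (orient O B P)) as [H|H].
    + right. apply in_triangle_of_orient; auto. rewrite orient_cycle. exact H2.
    + left. apply in_triangle_of_orient; auto.
      assert (orient B O P = - orient O B P) by (unfold orient; ring). lra.
Qed.

(** * Rotations and the incircle *)

Definition dot (P Q T : point) : R :=
  (fst T - fst P) * (fst Q - fst P) + (snd T - snd P) * (snd Q - snd P).

Definition sq_dist (P Q : point) : R := (fst Q - fst P) ^ 2 + (snd Q - snd P) ^ 2.

(** Multiplication by the complex number p + iq, an isometry when p^2 + q^2 = 1. *)
Definition rotate (p q : R) (P : point) : point :=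
  (p * fst P - q * snd P, q * fst P + p * snd P).

Lemma orient_rotate (p q : R) (P Q T : point) :
  p ^ 2 + q ^ 2 = 1 -> orient (rotate p q P) (rotate p q Q) (rotate p q T) = orient P Q T.
Proof.
  intros H. transitivity ((p ^ 2 + q ^ 2) * orient P Q T).
  - unfold orient, rotate. simpl. ring.
  - rewrite H. ring.
Qed.

Lemma dot_rotate (p q : R) (P Q T : point) :
  p ^ 2 + q ^ 2 = 1 -> dot (rotate p q P) (rotate p q Q) (rotate p q T) = dot P Q T.
Proof.
  intros H. transitivity ((p ^ 2 + q ^ 2) * dot P Q T).
  - unfold dot, rotate. simpl. ring.
  - rewrite H. ring.
Qed.

Lemma sq_dist_rotate (p q : R) (P Q : point) :
  p ^ 2 + q ^ 2 = 1 -> sq_dist (rotate p q P) (rotate p q Q) = sq_dist P Q.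
Proof.
  intros H. transitivity ((p ^ 2 + q ^ 2) * sq_dist P Q).
  - unfold sq_dist, rotate. simpl. ring.
  - rewrite H. ring.
Qed.

(** The orientations put [Z] at distance [r] from each side line, and the inner products put the
    contact points at the tangent lengths from the vertices. If [g] is negative, the contact points
    on the lines [AB] and [BC] lie beyond [B], on the extensions that concavity permits. *)
Lemma incircle_of_dot (O A B C Z : point) (r e f g h : R) :
  0 < r -> 0 < e -> 0 < f -> 0 < h -> 0 < f + g -> 0 < g + h ->
  sq_dist O A = (e + f) ^ 2 -> sq_dist A B = (f + g) ^ 2 ->
  sq_dist B C = (g + h) ^ 2 -> sq_dist C O = (h + e) ^ 2 ->
  orient O A Z = (e + f) * r -> orient A B Z = (f + g) * r ->
  orient B C Z = (g + h) * r -> orient C O Z = (h + e) * r ->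
  dot O A Z = e * (e + f) -> dot A B Z = f * (f + g) ->
  dot B C Z = g * (g + h) -> dot C O Z = h * (h + e) ->
  0 < orient O A B -> 0 < orient B C O -> (g <= 0 -> concave O A B C) ->
  incircle O A B C Z r.
Proof.
  intros Hr He Hf Hh Hb Hc da db dc dd oa ob oc od ta tb tc td HO1 HO2 Hg.
  assert (Hseg : forall l m P Q, 0 < l -> 0 < m ->
            on_segment P Q (along P Q (l / (l + m)))).
  { intros l m P Q Hl Hm. exists (l / (l + m)). split; [|reflexivity]. split.
    - apply Rmult_le_pos; [lra|]. left. apply Rinv_0_lt_compat. lra.
    - apply (Rmult_le_reg_r (l + m)); [lra|]. unfold Rdiv. rewrite Rmult_assoc, Rinv_l; lra. }
  split; [easy|]. split.
  - intros P HP. apply region_of_orient; auto.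
    + apply (orient_near O A Z P (e + f) r); auto; lra.
    + apply (orient_near A B Z P (f + g) r); auto; lra.
    + apply (orient_near B C Z P (g + h) r); auto; lra.
    + apply (orient_near C O Z P (h + e) r); auto; lra.
  - unfold sides. repeat constructor; simpl.
    + exists (along O A (e / (e + f))). split; [|left; auto].
      apply tangent_at_foot; auto; lra.
    + exists (along A B (f / (f + g))). split.
      * apply tangent_at_foot; auto; lra.
      * destruct (Rlt_dec 0 g); [left; auto | right; apply Hg; lra].
    + exists (along B C (g / (g + h))). split.
      * apply tangent_at_foot; auto; lra.
      * destruct (Rlt_dec 0 g); [left; auto | right; apply Hg; lra].
    + exists (along C O (h / (h + e))). split; [|left; auto].
      apply tangent_at_foot; auto; lra.
Qed.

(** * The circumcircle of [OAC] and the sign [delta] *)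

(* Let [Z'] be the centre of the circle through [O], [A], [C]. The power of [B]
   is linear in [Z'], and writing [B] in the basis [A], [C] evaluates it without
   computing [Z']. *)
Lemma power_circumcircle (O A B C Z : point) :
  sq_dist Z O = sq_dist Z A -> sq_dist Z A = sq_dist Z C ->
  (sq_dist Z B - sq_dist Z O) * orient C O A =
  sq_dist O B * orient C O A - sq_dist O A * orient B C O - sq_dist C O * orient O A B.
Proof.
  destruct O as [o1 o2], A as [a1 a2], B as [b1 b2], C as [c1 c2], Z as [z1 z2].
  unfold sq_dist, orient. simpl. intros H1 H2.
  assert (E1 : 2 * ((z1 - o1) * (a1 - o1) + (z2 - o2) * (a2 - o2)) = (a1 - o1) ^ 2 + (a2 - o2) ^ 2) by lra.
  assert (E2 : 2 * ((z1 - o1) * (c1 - o1) + (z2 - o2) * (c2 - o2)) = (c1 - o1) ^ 2 + (c2 - o2) ^ 2) by lra.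
  set (kA := (c1 - b1) * (o2 - b2) - (c2 - b2) * (o1 - b1)).
  set (kC := (a1 - o1) * (b2 - o2) - (a2 - o2) * (b1 - o1)).
  transitivity (((b1 - o1) ^ 2 + (b2 - o2) ^ 2) *
     ((o1 - c1) * (a2 - c2) - (o2 - c2) * (a1 - c1))
     - (2 * ((z1 - o1) * (a1 - o1) + (z2 - o2) * (a2 - o2))) * kA
     - (2 * ((z1 - o1) * (c1 - o1) + (z2 - o2) * (c2 - o2))) * kC).
  - unfold kA, kC. ring.
  - rewrite E1, E2. unfold kA, kC. ring.
Qed.

Lemma circumcenter_exists (O A C : point) :
  orient C O A <> 0 -> exists Z, sq_dist Z O = sq_dist Z A /\ sq_dist Z A = sq_dist Z C.
Proof.
  destruct O as [o1 o2], A as [a1 a2], C as [c1 c2]. unfold orient, sq_dist. simpl. intros H.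
  set (x := a1 - o1). set (y := a2 - o2). set (z := c1 - o1). set (w := c2 - o2).
  assert (HD : x * w - y * z <> 0).
  { intros E. apply H. rewrite <- E. unfold x, y, z, w. ring. }
  assert (Ea1 : a1 = o1 + x) by (unfold x; ring).
  assert (Ea2 : a2 = o2 + y) by (unfold y; ring).
  assert (Ec1 : c1 = o1 + z) by (unfold z; ring).
  assert (Ec2 : c2 = o2 + w) by (unfold w; ring).
  clearbody x y z w. subst.
  (* Cramer's rule for the equations of the perpendicular bisectors of [OA] and [OC]. *)
  exists (o1 + (w * (x ^ 2 + y ^ 2) - y * (z ^ 2 + w ^ 2)) / (2 * (x * w - y * z)),
          o2 + (x * (z ^ 2 + w ^ 2) - z * (x ^ 2 + y ^ 2)) / (2 * (x * w - y * z))).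
  simpl. split; field; auto.
Qed.

(** The power of [B] is the same for every centre equidistant from [O], [A], [C], so the existential
    reduces to its sign. *)
Lemma within_circumcircle_iff (O A B C : point) :
  0 < orient C O A ->
  within_circumcircle O A C B <->
  sq_dist O B * orient C O A < sq_dist O A * orient B C O + sq_dist C O * orient O A B.
Proof.
  intros HO. split.
  - intros [Z [H1 [H2 H3]]].
    apply distance_eq_sq in H1, H2. apply distance_lt_sq in H3.
    pose proof (power_circumcircle O A B C Z H1 H2) as E. unfold sq_dist in E at 1 2. nra.
  - intros H. destruct (circumcenter_exists O A C) as [Z [H1 H2]]; [lra|].
    exists Z. repeat split; try (now apply distance_eq_sq).
    pose proof (power_circumcircle O A B C Z H1 H2) as E.
    apply distance_lt_sq. change (sq_dist Z B < sq_dist Z O). nra.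
Qed.

(* [delta] compensates the sign lost by the square root. *)
Lemma delta_sqrt (O A B C : point) (k E : R) :
  0 < k -> 0 < orient C O A ->
  sq_dist O A * orient B C O + sq_dist C O * orient O A B - sq_dist O B * orient C O A = k * E ->
  delta O A B C * sqrt (E ^ 2) = E.
Proof.
  intros Hk HO HE. rewrite <- Rsqr_pow2, sqrt_Rsqr_abs. unfold delta.
  pose proof (within_circumcircle_iff O A B C HO) as W.
  destruct (excluded_middle_informative _) as [H|H].
  - apply W in H. rewrite Rabs_right; nra.
  - rewrite Rabs_left1; [ring|].
    apply Rnot_lt_le. intros H'. apply H, W. nra.
Qed.

(** * Algebra of the tangent lengths *)

(** With inradius 2 the half angle at [A] has tangent 2/f, so sin A = 4f/(f^2 + 4), and the identity
    amounts to ab sin A = 4ft. Exchanging the roles of [s] and [t] gives the analogue at [O]. *)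
Lemma tangent_length_angle (e f g h s t : R) :
  s <> 0 ->
  s * (e + g) = e + f + g + h -> t * (f + h) = e + f + g + h -> s * t = s + t ->
  e * g * s + f * h * t = 4 * s * t ->
  t * (f ^ 2 + 4) = (e + f) * (f + g).
Proof.
  intros Hs R1 R2 R3 R4. apply (Rmult_eq_reg_l s); [|easy].
  transitivity (f ^ 2 * (s * t) + 4 * s * t); [ring|]. rewrite R3, <- R4.
  transitivity (f * (t * (f + h)) + s * (e * g + f ^ 2)); [ring|].
  rewrite R2, <- R1. ring.
Qed.

(** These are the defining formulas of sigma and tau, with the signed square root replaced by
    [f * h - e * g]. *)
Lemma tangent_length_identities (e f g h s t : R) :
  0 < s -> 0 < t ->
  s * (e + g) = e + f + g + h -> t * (f + h) = e + f + g + h -> s * t = s + t ->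
  e * g * s + f * h * t = 4 * s * t ->
  (e + f) * (f + g) * (g + h) * (h + e) - 4 * (e + f + g + h) ^ 2 = (f * h - e * g) ^ 2 /\
  s * (16 + (e - g) ^ 2) = (e + f) * (h + e) + (f + g) * (g + h) + 2 * (f * h - e * g) /\
  t * (16 + (f - h) ^ 2) = (e + f) * (f + g) + (g + h) * (h + e) - 2 * (f * h - e * g).
Proof.
  intros Hs Ht R1 R2 R3 R4. repeat split.
  (* The classical formula for the squared inradius, here 4: the third elementary symmetric function
     of the tangent lengths divided by their sum. *)
  - assert (K : 4 * (e + f + g + h) = e * g * (f + h) + f * h * (e + g)).
    { apply (Rmult_eq_reg_l (s * t)); [|nra].
      transitivity ((4 * s * t) * (e + f + g + h)); [ring|]. rewrite <- R4.
      transitivity (e * g * s * (t * (f + h)) + f * h * t * (s * (e + g))); [|ring].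
      rewrite R1, R2. ring. }
    transitivity ((e + f) * (f + g) * (g + h) * (h + e)
                  - (e + f + g + h) * (4 * (e + f + g + h))); [ring|].
    rewrite K. ring.
  - assert (K : 4 * s - e * g * s = f * h - e * g).
    { apply (Rmult_eq_reg_l t); [|lra].
      transitivity (4 * s * t - e * g * (s * t)); [ring|]. rewrite <- R4, R3. ring. }
    transitivity (4 * (4 * s - e * g * s) + (s * (e + g)) * (e + g)); [ring|].
    rewrite K, R1. ring.
  - assert (K : 4 * t - f * h * t = e * g - f * h).
    { apply (Rmult_eq_reg_l s); [|lra].
      transitivity (4 * s * t - f * h * (s * t)); [ring|]. rewrite <- R4, R3. ring. }
    transitivity (4 * (4 * t - f * h * t) + (t * (f + h)) * (f + h)); [ring|].
    rewrite K, R2. ring.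
Qed.

(** With [O] at the origin and [A] at [(a, 0)], the pairs [(x1, x2)] and [(y1, y2)] are [a] times
    [B] and [C]: [x1] comes from ab cos A = t(f^2 - 4) and [y1] from ad cos O = s(e^2 - 4). The
    results are the squared lengths and the inner and cross products of [OB] and [OC], scaled by
    [a ^ 2]. *)
Lemma diagonal_identities (e f g h s t : R) :
  0 < e + f -> 0 < s -> 0 < t ->
  s * (e + g) = e + f + g + h -> t * (f + h) = e + f + g + h -> s * t = s + t ->
  e * g * s + f * h * t = 4 * s * t ->
  let a := e + f in
  let x1 := a * (e - g) + 8 * t in let x2 := 4 * f * t in
  let y1 := a * (h + e) - 8 * s in let y2 := 4 * e * s in
  x1 ^ 2 + x2 ^ 2 = a ^ 2 * ((e - g) ^ 2 + 16 * t) /\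
  y1 ^ 2 + y2 ^ 2 = a ^ 2 * (h + e) ^ 2 /\
  x1 * y1 + x2 * y2 = a ^ 2 * ((e - g) * (h + e) + 8 * t) /\
  x1 * y2 - x2 * y1 = a ^ 2 * (4 * h * t).
Proof.
  intros Ha Hs Ht R1 R2 R3 R4 a x1 x2 y1 y2.
  pose proof (tangent_length_angle e f g h s t ltac:(lra) R1 R2 R3 R4) as Tf.
  assert (Te : s * (e ^ 2 + 4) = (e + f) * (h + e)).
  { rewrite (tangent_length_angle f e h g t s); [ring|lra|lra|lra|lra|lra]. }
  fold a in Tf, Te. unfold x1, x2, y1, y2. repeat split.
  - transitivity ((a * (e - g)) ^ 2 + 16 * t * (t * (f ^ 2 + 4)) + 16 * t * (a * (e - g)));
      [ring|].
    rewrite Tf. unfold a. ring.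
  - transitivity ((a * (h + e)) ^ 2 + 16 * s * (s * (e ^ 2 + 4)) - 16 * s * (a * (h + e)));
      [ring|].
    rewrite Te. ring.
  - transitivity (a * (a * ((e - g) * (h + e) + 8 * t))
       - 8 * a * (s * (e + g)) + 16 * a * g * s - 8 * a * (t * (f + h)) + 16 * a * h * t
       - 16 * (4 * s * t) + 16 * e * f * (s * t)); [unfold a; ring|].
    rewrite <- R4, R3.
    transitivity (a * (a * ((e - g) * (h + e) + 8 * t)) - 8 * a * (s * (e + g))
       - 8 * a * (t * (f + h)) + 16 * f * (s * (e + g)) + 16 * e * (t * (f + h)));
      [unfold a; ring|].
    rewrite R1, R2. unfold a. ring.
  - transitivity (4 * a * ((2 * e - (e + g)) * e * s + 2 * (4 * s * t) - f * t * (h + e)));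
      [unfold a; ring|].
    rewrite <- R4.
    transitivity (4 * a * (2 * f * h * t - f * t * (h + e) + e * (2 * e * s + 2 * g * s - s * (e + g))));
      [ring|].
    transitivity (4 * a * (2 * f * h * t - f * t * (h + e) + e * (s * (e + g))));
      [ring|].
    rewrite R1, <- R2. unfold a. ring.
Qed.

(** * Construction of the quadrilateral from its tangent lengths *)

(** Before the rotation the incentre is [(e, 2)]. The corner triangles at [O], [A], [B], [C] have
    doubled signed areas 4es, 4ft, 4gs, 4ht, so only the one at [B] can be negative. The rotation
    stays arbitrary, to be chosen later so that the vertices are lattice points. *)
Lemma tangential_quadrilateral (e f g h s t p q : R) :
  0 < e -> 0 < f -> 0 < h -> g <> 0 -> 0 < f + g -> 0 < g + h -> 0 < s -> 0 < t ->
  s * (e + g) = e + f + g + h -> t * (f + h) = e + f + g + h -> s * t = s + t ->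
  e * g * s + f * h * t = 4 * s * t ->
  p ^ 2 + q ^ 2 = 1 ->
  let a := e + f in
  let O := (0, 0) in
  let A := rotate p q (a, 0) in
  let B := rotate p q ((a * (e - g) + 8 * t) / a, 4 * f * t / a) in
  let C := rotate p q ((a * (h + e) - 8 * s) / a, 4 * e * s / a) in
  quadrilateral O A B C /\ area O A B C = perimeter O A B C /\ tangential O A B C /\
  has_side_lengths O A B C (e + f) (f + g) (g + h) (h + e) /\
  (leq_sigma O A B C, leq_tau O A B C) = (s, t) /\
  (concave O A B C -> reflex A B C).
Proof.
  intros He Hf Hh Hg Hb Hc Hs Ht R1 R2 R3 R4 Hpq a O A B C.
  assert (Ha : a <> 0) by (unfold a; lra).
  pose proof (tangent_length_angle e f g h s t ltac:(lra) R1 R2 R3 R4) as Tf.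
  assert (Te : s * (e ^ 2 + 4) = (e + f) * (h + e)).
  { rewrite (tangent_length_angle f e h g t s); [ring|lra|lra|lra|lra|lra]. }
  pose proof (diagonal_identities e f g h s t ltac:(lra) Hs Ht R1 R2 R3 R4) as [X1 [X2 [X3 X4]]].
  fold a in Tf, Te, X1, X2, X3, X4.
  set (Z := rotate p q (e, 2)).
  set (A0 := (a, 0)) in *.
  set (B0 := ((a * (e - g) + 8 * t) / a, 4 * f * t / a)) in *.
  set (C0 := ((a * (h + e) - 8 * s) / a, 4 * e * s / a)) in *.
  set (Z0 := (e, 2)) in *.
  assert (EO : O = rotate p q O) by (unfold O, rotate; simpl; f_equal; ring).
  assert (B1 : a * fst B0 = a * (e - g) + 8 * t) by (simpl; field; auto).
  assert (B2 : a * snd B0 = 4 * f * t) by (simpl; field; auto).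
  assert (C1 : a * fst C0 = a * (h + e) - 8 * s) by (simpl; field; auto).
  assert (C2 : a * snd C0 = 4 * e * s) by (simpl; field; auto).
  (* The coordinates of [B0] and [C0] have denominator [a]; identities are checked after multiplying
     by [a] or its square. *)
  assert (Cancel : forall x y, a * x = a * y -> x = y)
    by (intros x y H; apply (Rmult_eq_reg_l a); auto).
  assert (oOAB : orient O A0 B0 = 4 * f * t).
  { unfold orient. cbn [fst snd O A0]. lra. }
  assert (oCOA : orient C0 O A0 = 4 * e * s).
  { unfold orient. cbn [fst snd O A0]. lra. }
  assert (oBCO : orient B0 C0 O = 4 * h * t).
  { apply Cancel, Cancel.
    transitivity ((a * fst B0) * (a * snd C0) - (a * snd B0) * (a * fst C0)).
    { unfold orient. cbn [fst snd O]. ring. }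
    rewrite B1, B2, C1, C2, X4. ring. }
  assert (dOA : sq_dist O A0 = (e + f) ^ 2).
  { unfold sq_dist. cbn [fst snd O A0]. unfold a. ring. }
  assert (dOB : sq_dist O B0 = (e - g) ^ 2 + 16 * t).
  { apply Cancel, Cancel.
    transitivity ((a * fst B0) ^ 2 + (a * snd B0) ^ 2).
    { unfold sq_dist. cbn [fst snd O]. ring. }
    rewrite B1, B2, X1. ring. }
  assert (dAB : sq_dist A0 B0 = (f + g) ^ 2).
  { transitivity (sq_dist O B0 - 2 * (a * fst B0) + a * a).
    { unfold sq_dist. cbn [fst snd O A0]. ring. }
    rewrite dOB, B1. unfold a. ring. }
  assert (dCO : sq_dist C0 O = (h + e) ^ 2).
  { apply Cancel, Cancel.
    transitivity ((a * fst C0) ^ 2 + (a * snd C0) ^ 2).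
    { unfold sq_dist. cbn [fst snd O]. ring. }
    rewrite C1, C2, X2. ring. }
  assert (BC : fst B0 * fst C0 + snd B0 * snd C0 = (e - g) * (h + e) + 8 * t).
  { apply Cancel, Cancel.
    transitivity ((a * fst B0) * (a * fst C0) + (a * snd B0) * (a * snd C0)); [ring|].
    rewrite B1, B2, C1, C2, X3. ring. }
  assert (dBC : sq_dist B0 C0 = (g + h) ^ 2).
  { transitivity (sq_dist O B0 + sq_dist C0 O - 2 * (fst B0 * fst C0 + snd B0 * snd C0)).
    { unfold sq_dist. cbn [fst snd O]. ring. }
    rewrite dOB, dCO, BC. ring. }
  assert (oABC : orient A0 B0 C0 = 4 * g * s).
  { transitivity (orient O A0 B0 + orient B0 C0 O - orient C0 O A0); [unfold orient; ring|].
    rewrite oOAB, oBCO, oCOA. lra. }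
  assert (oOAZ : orient O A0 Z0 = (e + f) * 2).
  { unfold orient. cbn [fst snd O A0 Z0]. unfold a. ring. }
  assert (oABZ : orient A0 B0 Z0 = (f + g) * 2).
  { apply Cancel.
    transitivity (2 * (a * fst B0 - a * a) + f * (a * snd B0)).
    { unfold orient. cbn [fst snd A0 Z0]. unfold a. ring. }
    rewrite B1, B2. transitivity (4 * (t * (f ^ 2 + 4)) - 2 * a * (f + g)); [unfold a; ring|].
    rewrite Tf. ring. }
  assert (oCOZ : orient C0 O Z0 = (h + e) * 2).
  { apply Cancel.
    transitivity (e * (a * snd C0) - 2 * (a * fst C0)).
    { unfold orient. cbn [fst snd O Z0]. ring. }
    rewrite C1, C2. transitivity (4 * (s * (e ^ 2 + 4)) - 2 * a * (h + e)); [ring|].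
    rewrite Te. unfold a. ring. }
  (* The four triangles with apex [Z0] have signed areas adding up to that of the quadrilateral. *)
  assert (oBCZ : orient B0 C0 Z0 = (g + h) * 2).
  { transitivity (orient O A0 B0 + orient B0 C0 O - orient O A0 Z0 - orient A0 B0 Z0 - orient C0 O Z0);
      [unfold orient; ring|].
    rewrite oOAB, oBCO, oOAZ, oABZ, oCOZ. lra. }
  assert (tOAZ : dot O A0 Z0 = e * (e + f)).
  { unfold dot. cbn [fst snd O A0 Z0]. unfold a. ring. }
  assert (tABZ : dot A0 B0 Z0 = f * (f + g)).
  { apply Cancel.
    transitivity (- f * (a * fst B0 - a * a) + 2 * (a * snd B0)).
    { unfold dot. cbn [fst snd A0 Z0]. unfold a. ring. }
    rewrite B1, B2. unfold a. ring. }
  assert (tCOZ : dot C0 O Z0 = h * (h + e)).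
  { transitivity (sq_dist C0 O - (e * fst C0 + 2 * snd C0)).
    { unfold dot, sq_dist. cbn [fst snd O Z0]. ring. }
    rewrite dCO. apply Cancel.
    transitivity (a * (h + e) ^ 2 - (e * (a * fst C0) + 2 * (a * snd C0))); [ring|].
    rewrite C1, C2. ring. }
  assert (tBCZ : dot B0 C0 Z0 = g * (g + h)).
  { transitivity (sq_dist C0 O - dot C0 O Z0 - dot A0 B0 Z0 - a * e - a * fst B0 + a ^ 2
       - (fst B0 * fst C0 + snd B0 * snd C0) + sq_dist O B0).
    { unfold dot, sq_dist. cbn [fst snd O A0 Z0]. ring. }
    rewrite dCO, tCOZ, tABZ, BC, B1, dOB. unfold a. ring. }
  (* The power of [B] with respect to the circle through [O], [A], [C] is a negative multiple of
     [f * h - e * g], so [delta] restores the sign of this difference. *)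
  assert (dl : delta O A B C * sqrt ((f * h - e * g) ^ 2) = f * h - e * g).
  { apply (delta_sqrt O A B C (4 * (e + f + g + h))); [lra| |];
      unfold A, B, C; rewrite EO, !orient_rotate, ?sq_dist_rotate by auto.
    - rewrite oCOA. auto 6 using Rmult_lt_0_compat with real.
    - rewrite oCOA, oBCO, oOAB, dOA, dOB, dCO.
      transitivity (4 * ((t * (f + h)) * (e ^ 2 + f * h) + 4 * e * f * h * t
         - e * (e - g) ^ 2 * s - 4 * e * (4 * s * t))); [ring|].
      rewrite <- R4, R2.
      transitivity (4 * ((e + f + g + h) * (e ^ 2 + f * h) - e * (e + g) * (s * (e + g)))); [ring|].
      rewrite R1. ring. }
  rewrite EO in dl |- *.
  assert (D : has_side_lengths (rotate p q O) A B C (e + f) (f + g) (g + h) (h + e)).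
  { unfold A, B, C. repeat split; apply distance_of_sq; try lra;
      [rewrite <- dOA | rewrite <- dAB | rewrite <- dBC | rewrite <- dCO];
      apply sq_dist_rotate; auto. }
  assert (pOAB : 0 < orient (rotate p q O) A B)
    by (unfold A, B; rewrite orient_rotate, oOAB by auto; auto using Rmult_lt_0_compat with real).
  assert (pBCO : 0 < orient B C (rotate p q O))
    by (unfold B, C; rewrite orient_rotate, oBCO by auto; auto using Rmult_lt_0_compat with real).
  assert (pCOA : 0 < orient C (rotate p q O) A)
    by (unfold A, C; rewrite orient_rotate, oCOA by auto; auto using Rmult_lt_0_compat with real).
  assert (pABC : orient A B C = 4 * g * s)
    by (unfold A, B, C; rewrite orient_rotate, oABC by auto; reflexivity).
  pose proof D as [D1 [D2 [D3 D4]]].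
  refine (conj _ (conj _ (conj _ (conj D (conj _ _))))).
  - apply quadrilateral_of_orient; auto. rewrite pABC.
    repeat apply Rmult_integral_contrapositive_currified; lra.
  - unfold area, perimeter. rewrite signed_area_orient, D1, D2, D3, D4, Rabs_right by lra.
    unfold A, B, C. rewrite !orient_rotate, oOAB, oBCO by auto. lra.
  - exists Z, 2. apply (incircle_of_dot _ _ _ _ _ _ e f g h); auto; try lra;
      unfold A, B, C, Z; rewrite ?orient_rotate, ?sq_dist_rotate, ?dot_rotate; auto.
    intros Hg0. unfold concave, reflex. right. right. left.
    fold A B C. rewrite pABC. clear - Hg Hg0 Hs. assert (g < 0) by lra. nra.
  - destruct (tangent_length_identities e f g h s t Hs Ht R1 R2 R3 R4) as [I1 [I2 I3]].
    unfold leq_sigma, leq_tau. rewrite D1, D2, D3, D4. cbv zeta.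
    replace ((e + f) * (f + g) * (g + h) * (h + e) - 4 * (e + f + (g + h)) ^ 2)
      with ((f * h - e * g) ^ 2) by (rewrite <- I1; ring).
    rewrite !Rmult_assoc, dl.
    f_equal.
    + replace (e + f - (f + g)) with (e - g) by ring.
      assert (16 + (e - g) ^ 2 <> 0) by (pose proof (pow2_ge_0 (e - g)); lra).
      apply (Rmult_eq_reg_r (16 + (e - g) ^ 2)); [|easy]. rewrite I2. field. easy.
    + replace (e + f - (h + e)) with (f - h) by ring.
      assert (16 + (f - h) ^ 2 <> 0) by (pose proof (pow2_ge_0 (f - h)); lra).
      apply (Rmult_eq_reg_r (16 + (f - h) ^ 2)); [|easy]. rewrite I3. field. easy.
  - unfold concave, reflex. intros [H|[H|[H|H]]]; lra.
Qed.

(** * Gaussian integers *)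

Definition gauss : Type := (Z * Z)%type.
Definition g0 : gauss := (0, 0)%Z.
Definition g1 : gauss := (1, 0)%Z.
Definition gadd (z w : gauss) : gauss := (fst z + fst w, snd z + snd w)%Z.
Definition gopp (z : gauss) : gauss := (- fst z, - snd z)%Z.
Definition gsub (z w : gauss) : gauss := gadd z (gopp w).
Definition gmul (z w : gauss) : gauss :=
  (fst z * fst w - snd z * snd w, fst z * snd w + snd z * fst w)%Z.
Definition gconj (z : gauss) : gauss := (fst z, - snd z)%Z.
Definition gnorm (z : gauss) : Z := (fst z ^ 2 + snd z ^ 2)%Z.
Definition gint (n : Z) : gauss := (n, 0%Z).

Lemma gauss_ring : ring_theory g0 g1 gadd gmul gsub gopp eq.
Proof.
  constructor; intros; try reflexivity;
    repeat match goal with z : gauss |- _ => destruct z end;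
    unfold g0, g1, gadd, gmul, gsub, gopp; cbn [fst snd]; f_equal; ring.
Qed.
Add Ring gauss_ring_structure : gauss_ring.

Lemma gnorm_pos (z : gauss) : z <> g0 -> (0 < gnorm z)%Z.
Proof.
  destruct z as [x y]. unfold gnorm, g0. cbn [fst snd]. intros H.
  assert (x <> 0 \/ y <> 0)%Z by (destruct (Z.eq_dec x 0); [right; intros ->; congruence | now left]).
  nia.
Qed.

(** The quotient z/w is z times the conjugate of w, divided by N. Rounding both coordinates to
    nearest integers leaves errors of at most 1/2, hence a remainder of norm at most N/2. *)
Lemma gauss_division (z w : gauss) :
  w <> g0 -> exists q, (gnorm (gsub z (gmul w q)) < gnorm w)%Z.
Proof.
  intros Hw. apply gnorm_pos in Hw. set (N := gnorm w) in *.
  assert (round : forall m, exists n, (- N <= 2 * (m - n * N) <= N)%Z).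
  { intros m. exists ((2 * m + N) / (2 * N))%Z.
    pose proof (Z.div_mod (2 * m + N) (2 * N) ltac:(lia)).
    pose proof (Z.mod_pos_bound (2 * m + N) (2 * N) ltac:(lia)). lia. }
  destruct z as [z1 z2], w as [w1 w2].
  destruct (round (z1 * w1 + z2 * w2)%Z) as [q1 H1].
  destruct (round (z2 * w1 - z1 * w2)%Z) as [q2 H2].
  exists (q1, q2).
  set (M := gnorm _).
  assert (E : (M * N = (z1 * w1 + z2 * w2 - q1 * N) ^ 2 + (z2 * w1 - z1 * w2 - q2 * N) ^ 2)%Z).
  { unfold M, N, gnorm, gsub, gadd, gmul, gopp. cbn [fst snd]. ring. }
  clearbody M N. set (X := (z1 * w1 + z2 * w2 - q1 * N)%Z) in *.
  set (Y := (z2 * w1 - z1 * w2 - q2 * N)%Z) in *. clearbody X Y.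
  assert (4 * X ^ 2 <= N ^ 2)%Z by nia. assert (4 * Y ^ 2 <= N ^ 2)%Z by nia. nia.
Qed.

(** Euclid's algorithm; the cofactors [u], [v] record that [k] divides both arguments. *)
Lemma gauss_bezout (z w : gauss) :
  exists k x y u v, k = gadd (gmul x z) (gmul y w) /\ z = gmul k u /\ w = gmul k v.
Proof.
  revert z. induction w as [w IH] using (induction_ltof1 _ (fun w => Z.to_nat (gnorm w))).
  intros z. destruct (excluded_middle_informative (w = g0)) as [->|Hw].
  - exists z, g1, g0, g1, g0. repeat split; ring.
  - destruct (gauss_division z w Hw) as [q Hq].
    destruct (IH (gsub z (gmul w q))) with (z := w) as [k [x [y [u [v [H1 [H2 H3]]]]]]].
    { unfold ltof. apply Z2Nat.inj_lt; auto; unfold gnorm; nia. }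
    exists k, y, (gsub x (gmul y q)), (gadd (gmul u q) v), u. repeat split; auto.
    + rewrite H1. ring.
    + transitivity (gadd (gsub z (gmul w q)) (gmul w q)); [ring|].
      rewrite H3. rewrite H2 at 1. ring.
Qed.

Lemma gconj_add (z w : gauss) : gconj (gadd z w) = gadd (gconj z) (gconj w).
Proof. unfold gconj, gadd. simpl. f_equal. ring. Qed.

Lemma gconj_mul (z w : gauss) : gconj (gmul z w) = gmul (gconj z) (gconj w).
Proof. unfold gconj, gmul. simpl. f_equal; ring. Qed.

Lemma gconj_conj (z : gauss) : gconj (gconj z) = z.
Proof. destruct z. unfold gconj. simpl. f_equal. ring. Qed.

Lemma gconj_int (n : Z) : gconj (gint n) = gint n.
Proof. reflexivity. Qed.

(* The rotation is multiplication by [gconj k / k]. *)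
Lemma rotate_by_conj_quotient (k m r : gauss) (a : Z) :
  a <> 0%Z -> k <> g0 -> gmul (gconj k) m = gmul (gmul (gint a) k) r ->
  rotate ((IZR (fst k) ^ 2 - IZR (snd k) ^ 2) / IZR (gnorm k))
         (- (2 * IZR (fst k) * IZR (snd k)) / IZR (gnorm k))
         (IZR (fst m) / IZR a, IZR (snd m) / IZR a) = (IZR (fst r), IZR (snd r)).
Proof.
  intros Ha Hk E. apply gnorm_pos in Hk. apply IZR_lt in Hk.
  assert (Ha' : IZR a <> 0) by (apply eq_IZR_contrapositive; exact Ha).
  assert (HN : IZR (gnorm k) = IZR (fst k) ^ 2 + IZR (snd k) ^ 2).
  { unfold gnorm. rewrite plus_IZR, !(pow_IZR _ 2). reflexivity. }
  (* Multiplying by [gconj k] turns the denominator [k] into the integer [gnorm k]. *)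
  assert (E' : gmul (gmul (gconj k) m) (gconj k) = gmul (gint (a * gnorm k)) r).
  { rewrite E. destruct k, r. unfold gmul, gint, gconj, gnorm. cbn [fst snd]. f_equal; ring. }
  destruct k as [k1 k2], m as [m1 m2], r as [r1 r2].
  unfold gmul, gconj, gint in E'. cbn [fst snd] in *.
  injection E' as E1 E2. apply (f_equal IZR) in E1, E2.
  repeat rewrite ?plus_IZR, ?minus_IZR, ?mult_IZR, ?opp_IZR in E1.
  repeat rewrite ?plus_IZR, ?minus_IZR, ?mult_IZR, ?opp_IZR in E2.
  set (N := IZR (gnorm (k1, k2))) in *. clearbody N. clear HN.
  unfold rotate. cbn [fst snd]. f_equal; apply (Rmult_eq_reg_l (IZR a * N));
    try (apply Rmult_integral_contrapositive_currified; lra).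
  - transitivity ((IZR k1 ^ 2 - IZR k2 ^ 2) * IZR m1 + 2 * IZR k1 * IZR k2 * IZR m2);
      [field; lra|]. lra.
  - transitivity ((IZR k1 ^ 2 - IZR k2 ^ 2) * IZR m2 - 2 * IZR k1 * IZR k2 * IZR m1);
      [field; lra|]. lra.
Qed.

(** Here [m] and [m'] are [a] times [B] and [C], and the hypotheses say that the squared lengths and
    B times the conjugate of C are Gaussian integers. For [k] a gcd of [a], [m], [m'], Bezout
    expresses [gconj k] through [a] and the conjugates of [m], [m']; each term of [gmul (gconj k) m]
    is then divisible by [a] times [k]. *)
Lemma rotation_to_lattice (a n : Z) (m m' K : gauss) (n' : Z) :
  a <> 0%Z ->
  gmul m (gconj m) = gint (a ^ 2 * n) -> gmul m' (gconj m') = gint (a ^ 2 * n') ->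
  gmul m (gconj m') = gmul (gint (a ^ 2)) K ->
  exists p q, p ^ 2 + q ^ 2 = 1 /\
    lattice_point (rotate p q (IZR a, 0)) /\
    lattice_point (rotate p q (IZR (fst m) / IZR a, IZR (snd m) / IZR a)) /\
    lattice_point (rotate p q (IZR (fst m') / IZR a, IZR (snd m') / IZR a)).
Proof.
  intros Ha Hm Hm' HK.
  destruct (gauss_bezout m m') as [k0 [x [y [u [u' [H1 [H2 H3]]]]]]].
  destruct (gauss_bezout (gint a) k0) as [k [z [w [ua [v [H4 [H5 H6]]]]]]].
  assert (Hk : k <> g0).
  { intros E. apply Ha. rewrite E in H5. unfold gint, gmul, g0 in H5. injection H5. cbn [fst snd]. lia. }
  assert (Ha2 : gint (a ^ 2) = gmul (gint a) (gint a)) by (unfold gint, gmul; cbn [fst snd]; f_equal; ring).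
  assert (Hi : forall i j, gint (i * j) = gmul (gint i) (gint j))
    by (intros; unfold gint, gmul; cbn [fst snd]; f_equal; ring).
  assert (HK' : gmul m' (gconj m) = gmul (gint (a ^ 2)) (gconj K)).
  { rewrite <- (gconj_int (a ^ 2)), <- gconj_mul, <- HK, gconj_mul, gconj_conj. ring. }
  rewrite Hi, Ha2 in Hm, Hm'. rewrite Ha2 in HK, HK'.
  assert (Ek : gconj k = gadd (gmul (gconj z) (gint a))
     (gmul (gconj w) (gadd (gmul (gconj x) (gconj m)) (gmul (gconj y) (gconj m'))))).
  { rewrite H4, H1. repeat rewrite ?gconj_add, ?gconj_mul. rewrite gconj_int. reflexivity. }
  set (N := IZR (gnorm k)).
  assert (HN : N = IZR (fst k) ^ 2 + IZR (snd k) ^ 2).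
  { unfold N, gnorm. rewrite plus_IZR, !(pow_IZR _ 2). reflexivity. }
  assert (HN0 : 0 < N) by (apply IZR_lt, gnorm_pos, Hk).
  exists ((IZR (fst k) ^ 2 - IZR (snd k) ^ 2) / N), (- (2 * IZR (fst k) * IZR (snd k)) / N).
  assert (HA : rotate ((IZR (fst k) ^ 2 - IZR (snd k) ^ 2) / N) (- (2 * IZR (fst k) * IZR (snd k)) / N) (IZR a, 0)
     = (IZR (fst (gmul (gconj k) ua)), IZR (snd (gmul (gconj k) ua)))).
  (* The point [A] is treated as a^2 divided by [a]. *)
  { rewrite <- (rotate_by_conj_quotient k (gint (a * a)) _ a Ha Hk).
    - unfold gint. cbn [fst snd]. rewrite mult_IZR. do 2 f_equal; field; apply eq_IZR_contrapositive; exact Ha.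
    - rewrite Hi. rewrite H5 at 1. ring. }
  repeat split.
  - field_simplify; [|lra]. rewrite HN. field. rewrite <- HN. lra.
  - do 2 eexists. exact HA.
  - do 2 eexists.
    apply (rotate_by_conj_quotient k m
      (gadd (gmul (gconj z) (gmul v u))
        (gmul (gconj w) (gadd (gmul (gconj x) (gmul ua (gint n))) (gmul (gconj y) (gmul ua K))))) a Ha Hk).
    rewrite Ek.
    transitivity (gadd (gmul (gint a) (gmul (gconj z) m))
       (gmul (gconj w) (gadd (gmul (gconj x) (gmul m (gconj m))) (gmul (gconj y) (gmul m (gconj m'))))));
      [ring|].
    (* In the first term [k] divides [m]; in the others a^2 supplies one factor [a], and the other
       one is a multiple of [k]. *)
    rewrite Hm, HK, H2, H6. rewrite H5 at 2 4. ring.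
  - do 2 eexists.
    apply (rotate_by_conj_quotient k m'
      (gadd (gmul (gconj z) (gmul v u'))
        (gmul (gconj w) (gadd (gmul (gconj x) (gmul ua (gconj K))) (gmul (gconj y) (gmul ua (gint n')))))) a Ha Hk).
    rewrite Ek.
    transitivity (gadd (gmul (gint a) (gmul (gconj z) m'))
       (gmul (gconj w) (gadd (gmul (gconj x) (gmul m' (gconj m))) (gmul (gconj y) (gmul m' (gconj m'))))));
      [ring|].
    rewrite Hm', HK', H3, H6. rewrite H5 at 2 4. ring.
Qed.

(** * Arithmetic of the side lengths *)

Lemma IZR_sq (z : Z) : IZR (z ^ 2) = IZR z ^ 2.
Proof. now rewrite (pow_IZR z 2). Qed.

(** The integers [T], [S], [U], [V] witness that aB and aC, and the products of [OB] and [OC], are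
    integral. Since 1/s + 1/t = 1, the quadratic hypothesis is the inradius condition in terms of
    the sides. *)
Lemma lattice_LEQ_exists (a b c d T S U V : Z) (s t : R) :
  (0 < b)%Z -> (0 < c)%Z -> (a + c = b + d)%Z -> 0 < s -> 0 < t -> s * t = s + t ->
  (IZR a + IZR c) ^ 2 =
    s * (16 + (IZR a - IZR b) ^ 2) + t * (16 + (IZR b - IZR c) ^ 2) ->
  side_conditions t (IZR a) (IZR b) (IZR c) (IZR d) ->
  IZR T = 8 * t -> IZR S = 8 * s ->
  IZR U = 2 * t * (IZR b - IZR c) -> IZR V = 2 * s * (IZR a - IZR b) ->
  exists O A B C : point,
    LEQ O A B C /\ tangential O A B C /\
    has_side_lengths O A B C (IZR a) (IZR b) (IZR c) (IZR d) /\
    (leq_sigma O A B C, leq_tau O A B C) = (s, t) /\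
    (concave O A B C -> reflex A B C).
Proof.
  intros Hb Hc Hd Hs Ht Hst HS [Hi [Hii Hiii]] ET ES EU EV.
  apply (f_equal IZR) in Hd. rewrite !plus_IZR in Hd.
  pose proof (IZR_lt _ _ Hb) as Hb'. pose proof (IZR_lt _ _ Hc) as Hc'.
  set (l := IZR a + IZR c) in *.
  assert (Hl : l / s = l - l / t).
  { apply (Rmult_eq_reg_l (s * t)); [|nra].
    transitivity (l * t); [field; lra|]. transitivity (l * (s * t) - l * s); [|field; lra].
    rewrite Hst. ring. }
  assert (Hdiv : forall x, x * t < l -> x < l / t).
  { intros x Hx. apply (Rmult_lt_reg_r t); [easy|]. unfold Rdiv. rewrite Rmult_assoc, Rinv_l; lra. }
  assert (Hmul : forall x, x = l / t -> x * t = l) by (intros x ->; field; lra).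
  assert (Hii' : l / t < IZR a + IZR d).
  { apply (Rmult_lt_reg_r t); [easy|]. unfold Rdiv. rewrite Rmult_assoc, Rinv_l; lra. }
  (* Solutions of e + g = l/s, e - g = a - b, f + h = l/t, f - h = b - c. *)
  set (e := (l / s + IZR a - IZR b) / 2). set (g := (l / s - IZR a + IZR b) / 2).
  set (f := (l / t + IZR b - IZR c) / 2). set (h := (l / t - IZR b + IZR c) / 2).
  assert (Ea : IZR a = e + f) by (unfold e, f; rewrite Hl; unfold l; lra).
  assert (Eb : IZR b = f + g) by (unfold f, g; rewrite Hl; unfold l; lra).
  assert (Ec : IZR c = g + h) by (unfold g, h; rewrite Hl; unfold l; lra).
  assert (Ed : IZR d = h + e) by (unfold l in Hd; lra).
  assert (He : 0 < e) by (unfold e; rewrite Hl; lra).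
  assert (Hf : 0 < f).
  { pose proof (Hdiv _ Hi). pose proof (Rle_abs (IZR c - IZR b)). unfold f. lra. }
  assert (Hh : 0 < h).
  { pose proof (Hdiv _ Hi). pose proof (Rle_abs (- (IZR c - IZR b))) as H'.
    rewrite Rabs_Ropp in H'. unfold h. lra. }
  assert (Hg : g <> 0).
  { intros E. apply Hiii, Hmul. unfold g in E. rewrite Hl in E. unfold l in *. lra. }
  assert (R1 : s * (e + g) = e + f + g + h).
  { transitivity l; [unfold e, g; field; lra | unfold l; lra]. }
  assert (R2 : t * (f + h) = e + f + g + h).
  { transitivity l; [unfold f, h; field; lra | unfold l; lra]. }
  assert (R4 : e * g * s + f * h * t = 4 * s * t).
  { apply (Rmult_eq_reg_l 4); [|lra].
    transitivity (s * (e + g) * (e + g) + t * (f + h) * (f + h) - s * (e - g) ^ 2 - t * (f - h) ^ 2);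
      [ring|].
    rewrite R1, R2.
    transitivity (l ^ 2 - s * (IZR a - IZR b) ^ 2 - t * (IZR b - IZR c) ^ 2);
      [rewrite Ea, Eb, Ec; unfold l; rewrite Ea, Ec; ring|].
    rewrite HS. transitivity (16 * (s + t)); [ring|]. rewrite <- Hst. ring. }
  pose proof (diagonal_identities e f g h s t ltac:(lra) Hs Ht R1 R2 Hst R4) as [X1 [X2 [X3 X4]]].
  clearbody e f g h.
  assert (Ha : a <> 0%Z) by (intros ->; lra).
  assert (EU' : IZR U = 2 * t * (f - h)) by (rewrite EU, Eb, Ec; ring).
  assert (EV' : IZR V = 2 * s * (e - g)) by (rewrite EV, Ea, Eb; ring).
  (* These are aB and aC; the second coordinates use 4ft = 2t(f + h) + 2t(f - h) and 4es = 2s(e + g)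
     + 2s(e - g). *)
  set (m := (a * (a - b) + T, 2 * (a + c) + U)%Z).
  set (m' := (a * d - S, 2 * (a + c) + V)%Z).
  assert (M1 : IZR (fst m) = (e + f) * (e - g) + 8 * t).
  { unfold m. cbn [fst]. rewrite plus_IZR, mult_IZR, minus_IZR, ET, Ea, Eb. ring. }
  assert (M2 : IZR (snd m) = 4 * f * t).
  { unfold m. cbn [snd]. rewrite plus_IZR, mult_IZR, plus_IZR, EU'. rewrite Ea, Ec. lra. }
  assert (M3 : IZR (fst m') = (e + f) * (h + e) - 8 * s).
  { unfold m'. cbn [fst]. rewrite minus_IZR, mult_IZR, ES, Ea, Ed. ring. }
  assert (M4 : IZR (snd m') = 4 * e * s).
  { unfold m'. cbn [snd]. rewrite plus_IZR, mult_IZR, plus_IZR, EV'. rewrite Ea, Ec. lra. }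
  (* The witnesses are |OB|^2, the inner product of [OB] and [OC] with minus their cross product
     4ht, and |OC|^2. *)
  destruct (rotation_to_lattice a ((a - b) ^ 2 + 2 * T) m m'
     ((a - b) * d + T, - (2 * (a + c) - U))%Z (d ^ 2) Ha) as [p [q [Hpq [LA [LB LC]]]]].
  - unfold gmul, gconj, gint. cbn [fst snd]. f_equal; [|ring]. apply eq_IZR.
    rewrite minus_IZR, !mult_IZR, opp_IZR, plus_IZR, mult_IZR, !IZR_sq, minus_IZR, M1, M2, ET, Ea, Eb.
    transitivity (((e + f) * (e - g) + 8 * t) ^ 2 + (4 * f * t) ^ 2); [ring|]. rewrite X1. ring.
  - unfold gmul, gconj, gint. cbn [fst snd]. f_equal; [|ring]. apply eq_IZR.
    rewrite minus_IZR, !mult_IZR, opp_IZR, !IZR_sq, M3, M4, Ea, Ed.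
    transitivity (((e + f) * (h + e) - 8 * s) ^ 2 + (4 * e * s) ^ 2); [ring|]. rewrite X2. ring.
  - unfold gmul, gconj, gint. cbn [fst snd]. f_equal; apply eq_IZR.
    + rewrite !minus_IZR, !mult_IZR, !opp_IZR, plus_IZR, mult_IZR, !IZR_sq, minus_IZR, M1, M2, M3, M4, ET, Ea, Eb, Ed.
      transitivity (((e + f) * (e - g) + 8 * t) * ((e + f) * (h + e) - 8 * s) + 4 * f * t * (4 * e * s));
        [ring|]. rewrite X3. ring.
    + rewrite !plus_IZR, !mult_IZR, !opp_IZR, minus_IZR, mult_IZR, plus_IZR, !IZR_sq, M1, M2, M3, M4, EU', Ea, Ec.
      transitivity (- (((e + f) * (e - g) + 8 * t) * (4 * e * s) - 4 * f * t * ((e + f) * (h + e) - 8 * s)));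
        [ring|]. rewrite X4.
      transitivity (- (e + f) ^ 2 * (2 * (t * (f + h)) - 2 * t * (f - h))); [ring|]. rewrite R2. ring.
  - rewrite M1, M2 in LB. rewrite M3, M4 in LC. rewrite Ea in LA, LB, LC.
    destruct (tangential_quadrilateral e f g h s t p q) as [Q1 [Q2 [Q3 [Q4 [Q5 Q6]]]]]; auto; try lra.
    do 4 eexists. rewrite Ea, Eb, Ec, Ed.
    refine (conj (conj Q1 (conj _ Q2)) (conj Q3 (conj Q4 (conj Q5 Q6)))).
    repeat split; auto. exists 0%Z, 0%Z. reflexivity.
Qed.

(** The integer [k] is the side b in case (I) and d in case (II). As a - b = d - c and b - c = a -
    d, this one equation is the inradius condition in both. *)
Lemma side_length_equation (x k u v c : R) :
  x <> 1 -> u + v = k * x ->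
  (2 * x) ^ 2 + u ^ 2 = v ^ 2 - (v - (x - 1) / 2 * c) ^ 2 ->
  (v - u + c) ^ 2 = x / (x - 1) * (16 + (v - u - k) ^ 2) + x * (16 + (k - c) ^ 2).
Proof.
  intros Hx Hu H. replace u with (k * x - v) in * by lra.
  apply (Rmult_eq_reg_l (x - 1)); [|lra].
  transitivity (x * (16 + (v - (k * x - v) - k) ^ 2) + (x - 1) * x * (16 + (k - c) ^ 2));
    [|field; lra].
  lra.
Qed.

(** This makes 2x/(x - 1) times [v - u - k] an integer. For x = 9 parity is needed: the right side
    of the equation is even, hence so is u = 9k - v, and [v] and [k] have equal parity. *)
Lemma difference_divisible (x u v c k : Z) :
  x = 2%Z \/ x = 3%Z \/ x = 5%Z \/ x = 9%Z -> (u + v = k * x)%Z ->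
  (2 * IZR x) ^ 2 + IZR u ^ 2 = IZR v ^ 2 - (IZR v - (IZR x - 1) / 2 * IZR c) ^ 2 ->
  exists j, (2 * (v - u - k) = (x - 1) * j)%Z.
Proof.
  intros hx hk heq.
  assert (Hu : u = (k * x - v)%Z) by lia.
  destruct hx as [E|[E|[E|E]]]; subst x.
  - eexists. replace (2 - 1)%Z with 1%Z by lia. rewrite Z.mul_1_l. reflexivity.
  - exists (v - u - k)%Z. lia.
  - exists (v - 3 * k)%Z. lia.
  - assert (H : (324 + u ^ 2 = v ^ 2 - (v - 4 * c) ^ 2)%Z).
    { apply eq_IZR.
      repeat rewrite ?minus_IZR, ?mult_IZR, ?plus_IZR, ?IZR_sq. lra. }
    assert (Hpar : exists i, (v - 5 * k = 2 * i)%Z).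
    { rewrite Hu in H.
      destruct (Z.Even_or_Odd v) as [[i Hi]|[i Hi]], (Z.Even_or_Odd k) as [[j Hj]|[j Hj]].
      - exists (i - 5 * j)%Z. lia.
      - exfalso. rewrite Hi, Hj in H. ring_simplify in H. lia.
      - exfalso. rewrite Hi, Hj in H. ring_simplify in H. lia.
      - exists (i - 5 * j - 2)%Z. lia. }
    destruct Hpar as [i Hi]. exists i. lia.
Qed.

Theorem theorem2 (x u v c : Z)
  (hx : x = 2%Z \/ x = 3%Z \/ x = 5%Z \/ x = 9%Z)
  (heq : (2 * IZR x) ^ 2 + IZR u ^ 2
         = IZR v ^ 2 - (IZR v - (IZR x - 1) / 2 * IZR c) ^ 2)
  (hmod : (x | u + v)%Z)
  (hc : (0 < c)%Z)
  (hc2 : x = 2%Z -> Z.Even c)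
  (hc3 : x = 3%Z -> ~ (3 | c)%Z) :
  (forall t a b d : R,
     t = IZR x ->
     a = IZR v - IZR u ->
     b = (IZR v + IZR u) / t ->
     d = a + IZR c - b ->
     side_conditions t a b (IZR c) d ->
     exists O A B C : point,
       LEQ O A B C /\ tangential O A B C /\
       has_side_lengths O A B C a b (IZR c) d /\
       (leq_sigma O A B C, leq_tau O A B C) = (t / (t - 1), t) /\
       (concave O A B C -> reflex A B C)) /\
  (forall s t a b d : R,
     s = IZR x ->
     t = s / (s - 1) ->
     a = IZR v - IZR u ->
     d = (IZR v + IZR u) / s ->
     b = a + IZR c - d ->
     side_conditions t a b (IZR c) d ->
     0 < b ->
     exists O A B C : point,
       LEQ O A B C /\ tangential O A B C /\
       has_side_lengths O A B C a b (IZR c) d /\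
       (leq_sigma O A B C, leq_tau O A B C) = (s, t) /\
       (concave O A B C -> reflex A B C)).
Proof.
  destruct hmod as [k hk].
  destruct (difference_divisible x u v c k hx hk heq) as [j hj].
  (* As x - 1 divides 8, the number 8x/(x - 1) is the integer xw. *)
  assert (hw : exists w, ((x - 1) * w = 8)%Z).
  { destruct hx as [->|[->|[->| ->]]]; [exists 8%Z|exists 4%Z|exists 2%Z|exists 1%Z]; reflexivity. }
  destruct hw as [w hw].
  assert (hx1 : 2 <= IZR x) by (apply IZR_le; lia).
  pose proof (f_equal IZR hk) as rk. rewrite plus_IZR, mult_IZR in rk.
  pose proof (f_equal IZR hj) as rj. rewrite !mult_IZR, !minus_IZR in rj.
  pose proof (f_equal IZR hw) as rw. rewrite mult_IZR, minus_IZR in rw.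
  pose proof (IZR_lt _ _ hc) as rc.
  pose proof (side_length_equation (IZR x) (IZR k) (IZR u) (IZR v) (IZR c) ltac:(lra) rk heq) as E.
  assert (Hk : (IZR v + IZR u) / IZR x = IZR k).
  { rewrite Rplus_comm, rk. field. lra. }
  assert (Hr : 0 < IZR x / (IZR x - 1)) by (apply Rdiv_lt_0_compat; lra).
  assert (Hsum : IZR x / (IZR x - 1) * IZR x = IZR x / (IZR x - 1) + IZR x) by (field; lra).
  assert (Hw : IZR (x * w) = 8 * (IZR x / (IZR x - 1))).
  { rewrite mult_IZR, <- rw. field. lra. }
  assert (Hj : IZR (x * j) = 2 * (IZR x / (IZR x - 1)) * (IZR v - IZR u - IZR k)).
  { rewrite mult_IZR. transitivity (IZR x / (IZR x - 1) * (2 * (IZR v - IZR u - IZR k))); [|ring].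
    rewrite rj. field. lra. }
  rewrite <- (minus_IZR v u) in E, Hj.
  split.
  - intros t a b d -> -> -> -> hside. rewrite Hk, <- (minus_IZR v u), <- plus_IZR, <- (minus_IZR (v - u + c)) in hside |- *.
    apply (lattice_LEQ_exists (v - u) k c (v - u + c - k) (8 * x) (x * w) (2 * x * (k - c)) (x * j));
      auto; try lra; try lia.
    (* The equation makes v^2 - u^2 = xab positive. Were b nonpositive, a would be negative, and (i)
       would give c <= |c - b| <= |c - b|x < a + c < c. *)
    + assert (Hab : 0 < (IZR v - IZR u) * IZR k).
      { pose proof (pow2_ge_0 (IZR v - (IZR x - 1) / 2 * IZR c)).
        assert (IZR x * ((IZR v - IZR u) * IZR k) = IZR v ^ 2 - IZR u ^ 2) as Ev.
        { transitivity ((IZR v - IZR u) * (IZR k * IZR x)); [ring|]. rewrite <- rk. ring. }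
        apply (Rmult_lt_reg_l (IZR x)); [lra|]. rewrite Rmult_0_r, Ev. nra. }
      rewrite <- (minus_IZR v u) in Hab.
      apply lt_IZR, Rnot_le_lt. intros Hk0. destruct hside as [Hi _].
      pose proof (Rle_abs (IZR c - IZR k)).
      assert (IZR (v - u) < 0) by nra.
      assert (Rabs (IZR c - IZR k) * 1 <= Rabs (IZR c - IZR k) * IZR x)
        by (apply Rmult_le_compat_l; [apply Rabs_pos | lra]).
      lra.
    + rewrite mult_IZR. reflexivity.
    + rewrite !mult_IZR, minus_IZR. reflexivity.
  - intros s t a b d -> -> -> -> -> hside hb. rewrite Hk, <- (minus_IZR v u), <- plus_IZR, <- (minus_IZR (v - u + c)) in hside, hb |- *.
    (* The values of sigma and tau from case (I) are exchanged, and with them the witnesses; [x * j]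
       serves for [U] because b - c = a - d. *)
    apply (lattice_LEQ_exists (v - u) (v - u + c - k) c k (x * w) (8 * x) (x * j)
             (2 * x * (v - u - (v - u + c - k)))); auto; try lra; try lia.
    + now apply lt_IZR.
    + rewrite E, (minus_IZR (v - u + c)), plus_IZR. ring.
    + rewrite mult_IZR. reflexivity.
    + rewrite Hj, (minus_IZR (v - u + c)), plus_IZR. ring.
    + rewrite !mult_IZR, minus_IZR. reflexivity.
Qed.
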